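(* There exists a deterministic online algorithm for the online light approximate shortest-path tree problem that maintains a tree $H$ connecting the root and all arrived terminals such that the cost of $H$ is at most $O(\log k)$ times the cost of a minimum spanning tree on the terminals and the root, and $d_H(v,r)\le 7\,d(v,r)$ for every terminal $v$, where $k$ is the number of terminals.
   Context: Online LAST problem: there is a metric space $(V,d)$ with a root (sink) $r$. Terminals arrive one by one; when a terminal arrives, its distances to $r$ and to the previously arrived terminals are revealed, and the algorithm irrevocably adds edges (pairs of revealed points, with cost equal to their distance) to its subgraph $H$. The cost of $H$ is the sum of the lengths of its edges; $d_H$ is the shortest-path distance in $H$. $\mathrm{MST}$ denotes the cost of a minimum spanning tree on the set consisting of $r$ and the arrived terminals. *)

(* Defs.v *)
From mathcomp Require Import all_boot all_order all_algebra.
From mathcomp Require Import all_classical all_reals all_analysis.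

Set Implicit Arguments.
Unset Strict Implicit.
Unset Printing Implicit Defensive.
Import Order.TTheory GRing.Theory Num.Theory.
Local Open Scope ring_scope.
Local Open Scope classical_set_scope.

(* The library's [connect] is a boolean reflexive-transitive closure, [ucycle]
   a closed walk with pairwise distinct vertices.  In a simple graph every edge
   yields a [ucycle] of length 2, so genuine cycles have length at least 3. *)
Definition is_tree (V : finType) (G : rel V) : Prop :=
  [/\ irreflexive G, symmetric G,
      forall x y, connect G x y &
      forall c : seq V, ucycle G c -> (size c <= 2)%N].

Section WeightedGraphs.
Variables (R : realType) (n : nat).
Implicit Types (D : 'M[R]_n) (G : rel 'I_n).

(* Each unordered edge {i, j} is counted once, as (i, j) with i < j. *)
Definition graph_cost D G : R := \sum_(i < n) \sum_(j < n | (i < j)%N && G i j) D i j.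

Definition walk_length D (x : 'I_n) (p : seq 'I_n) : R :=
  \sum_(e <- zip (x :: p) p) D e.1 e.2.

(* Extended-real valued: +oo when x and y are not connected in G. *)
Definition graph_dist D G (x y : 'I_n) : \bar R :=
  ereal_inf [set (walk_length D x p)%:E | p in [set p | path G x p /\ last x p = y]].

Definition is_mst D G : Prop :=
  is_tree G /\ forall G' : rel 'I_n, is_tree G' -> graph_cost D G <= graph_cost D G'.

End WeightedGraphs.

Lemma star_is_tree n :
  is_tree [rel i j : 'I_n.+1 | (i == ord0) (+) (j == ord0)].
Proof.
set G := [rel i j | _]; have Gsym : symmetric G by move=> x y /=; rewrite addbC.
split=> // [x|x y|[|x [|y [|z s]]]] //=; first by rewrite addbb.
- have conn0 z : connect G z ord0.
    have [->|z0] := eqVneq z ord0; first exact: connect0.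
    by apply: connect1; rewrite /G /= eqxx (negbTE z0).
  apply: connect_trans (conn0 x) _.
  by rewrite (sym_connect_sym Gsym).
- case/andP=> /=; case: s => [|w s] /=.
    by case: (x == _); case: (y == _); case: (z == _).
  rewrite !inE !negb_or.
  have nd (a b : 'I_n.+1) : a != b -> ~~ ((a == ord0) && (b == ord0)).
    by apply: contra => /andP[/eqP-> /eqP->].
  move=> /and4P[xy yz zw _] /and4P[/and4P[_ /nd xz _ _] /and3P[_ /nd yw _] _ _].
  by move: xy yz zw xz yw; case: (x == _); case: (y == _); case: (z == _); case: (w == _).
Qed.

Lemma exists_mst (R : realType) n (D : 'M[R]_n.+1) :
  exists T : rel 'I_n.+1, is_mst D T.
Proof.
pose rel_of (f : {ffun 'I_n.+1 * 'I_n.+1 -> bool}) : rel 'I_n.+1 :=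
  fun i j => f (i, j).
pose code (G : rel 'I_n.+1) := [ffun e : 'I_n.+1 * 'I_n.+1 => G e.1 e.2].
have codeK G : rel_of (code G) = G.
  by apply/funext=> i; apply/funext=> j; rewrite /rel_of ffunE.
pose P f := `[< is_tree (rel_of f) >].
pose star : rel 'I_n.+1 := [rel i j | (i == ord0) (+) (j == ord0)].
have Pstar : P (code star) by apply/asboolP; rewrite codeK; exact: star_is_tree.
have [f /asboolP treef minf] :=
  arg_minP (fun f => graph_cost D (rel_of f)) Pstar.
exists (rel_of f); split=> // G treeG; rewrite -[G]codeK.
by apply: minf; apply/asboolP; rewrite codeK.
Qed.

Section Online.
Variable R : realType.

(* After the m-th arrival the revealed points are numbered 0, ..., m (0 is the
   root, i the i-th terminal) and all that is known is their distance matrix.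
   A deterministic algorithm maps it to the set of edges added at that moment;
   past matrices and past decisions are determined by the current matrix. *)
Definition online_algorithm : Type :=
  forall m : nat, 'M[R]_m.+1 -> {set 'I_m.+1 * 'I_m.+1}.

Variables (V : metricType R) (r : V) (t : nat -> V).

Definition point (i : nat) : V := if i is j.+1 then t j else r.

Definition revealed (m : nat) : 'M[R]_m.+1 :=
  \matrix_(i, j) mdist (point i) (point j).

Variable A : online_algorithm.

Definition added (m : nat) (i j : nat) : bool :=
  [exists e in A (revealed m), (e.1 == i :> nat) && (e.2 == j :> nat)].

(* The subgraph H after n arrivals: every edge added at a moment m <= n, with no
   deletions. *)
Definition online_graph (n : nat) : rel 'I_n.+1 :=
  fun i j => [exists m : 'I_n.+1, added m i j || added m j i].

End Online.

(* Main.v *)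
(* A new terminal v is joined to the nearest earlier u satisfying
   h(u) + 7 d(u,v) <= 7 d(v,r), where h is the depth in the current tree; the root
   always qualifies.  Hence h(v) <= 7 d(v,r) - 6 pay(v), where pay(v) is the length
   of the added edge: a terminal that paid much has a large slack.  So if u came
   before v and d(u,v) < (3/7) pay(u), then v could have been joined to u, and
   pay(v) <= d(u,v).  Thus the terminals that paid at least L are, together with
   the root, (3/7) L-separated, and disjoint balls around them show that there are
   at most O(MST / L) of them: the j-th largest payment is O(MST / j), and the
   harmonic sum gives the factor O(log k). *)

Require Import Defs.
From mathcomp Require Import all_boot all_order all_algebra.
From mathcomp Require Import all_classical all_reals all_analysis.
From mathcomp Require Import ring lra.
Set Implicit Arguments.
Unset Strict Implicit.
Unset Printing Implicit Defensive.
Import Order.TTheory GRing.Theory Num.Theory.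
Local Open Scope ring_scope.

(** * Variation of functions on a graph and the packing bound *)

(** The factor 2 counts each edge in both orientations: prepending [x] adds a row and a column to
    the double sum, and each contains the variation along the edge from [x] to the next vertex
    [y]. *)
Lemma path_variation (R : realType) (T : finType) (G : rel T) (f : T -> R)
    (x : T) (p : seq T) :
  symmetric G -> path G x p ->
  2 * (f x - f (last x p)) <=
    \sum_(i <- x :: p) \sum_(j <- x :: p | G i j) `|f i - f j|.
Proof.
move=> Gsym; pose F i j := if G i j then `|f i - f j| else 0.
have F0 i j : 0 <= F i j by rewrite /F; case: ifP.
have -> : \sum_(i <- x :: p) \sum_(j <- x :: p | G i j) `|f i - f j| =
    \sum_(i <- x :: p) \sum_(j <- x :: p) F i j.
  by apply: eq_bigr => i _; rewrite big_mkcond.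
elim: p x => [|y p IHp] x /= => [_|/andP[Gxy /IHp {}IHp]].
  by rewrite subrr mulr0 !big_seq1.
rewrite big_cons.
under [X in _ <= _ + X]eq_bigr do rewrite big_cons.
rewrite big_split /=.
have row : f x - f y <= \sum_(j <- [:: x, y & p]) F x j.
  rewrite 2!big_cons /= {2}/F Gxy addrCA (le_trans (ler_norm _))// lerDl.
  by rewrite addr_ge0 ?sumr_ge0.
have col : f x - f y <= \sum_(i <- y :: p) F i x.
  rewrite big_cons {1}/F Gsym Gxy distrC (le_trans (ler_norm _))// lerDl.
  by rewrite sumr_ge0.
by move: IHp row col; lra.
Qed.

(** A shortened path has no repeated vertex, so the double sum over its vertices is part of the
    nonnegative double sum over [T]. *)
Lemma connected_variation (R : realType) (T : finType) (G : rel T) (f : T -> R)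
    (x y : T) :
  symmetric G -> connect G x y ->
  2 * (f x - f y) <= \sum_i \sum_(j | G i j) `|f i - f j|.
Proof.
move=> Gsym /connectP[p0 /shortenP[p Gp Up _] ->].
apply: le_trans (path_variation f Gsym Gp) _.
have sub (P : pred T) (F : T -> R) : (forall i, 0 <= F i) ->
    \sum_(i <- x :: p | P i) F i <= \sum_(i | P i) F i.
  move=> F0; rewrite big_mkcond [leRHS]big_mkcond /= big_uniq //=.
  rewrite [leRHS](bigID (mem (x :: p))) /= lerDl sumr_ge0 // => i _.
  by case: ifP.
apply: le_trans (sub predT _ _); last by move=> i; rewrite sumr_ge0.
by apply: ler_sum => i _; apply: sub => j.
Qed.

(* The truncated distances [f s] to the points s of S have disjoint supports, so
   their variations along an edge xy add up to at most [d x y]; each of them drops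
   from delta / 2 to 0 somewhere in G. *)
Lemma packing (R : realType) (T : finType) (G : rel T) (d : T -> T -> R)
    (S : {set T}) (delta : R) :
  (forall x, d x x = 0) -> (forall x y, d x y = d y x) ->
  (forall x y z, d x z <= d x y + d y z) ->
  symmetric G -> (forall x y, connect G x y) ->
  0 <= delta -> (1 < #|S|)%N ->
  {in S &, forall x y, x != y -> delta <= d x y} ->
  #|S|%:R * delta <= \sum_x \sum_(y | G x y) d x y.
Proof.
move=> d0 dC dT Gsym Gconn delta0 S1 sep.
have dge0 x y : 0 <= d x y.
  by have := dT x y x; rewrite d0 (dC y x); lra.
pose f s x : R := Num.max 0 (delta / 2 - d s x).
have f0 s x : 0 <= f s x by rewrite le_max lexx.
have fE s x : 0 < f s x -> f s x = delta / 2 - d s x.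
  by rewrite /f maxEle; case: ifP => //; rewrite ltxx.
have fge s x : delta / 2 - d s x <= f s x by rewrite le_max lexx orbT.
have flip s x y : `|f s x - f s y| <= d x y.
  rewrite ler_norml.
  have := dT s x y; have := dT s y x; rewrite (dC y x) => h1 h2.
  have := fge s x; have := fge s y; have := f0 s x; have := f0 s y.
  have := dge0 x y.
  case: (ltrP 0 (f s x)) => [/fE|] hx; case: (ltrP 0 (f s y)) => [/fE|] hy;
  move=> *; apply/andP; split; lra.
have sepf s s' x : s \in S -> s' \in S -> s != s' -> 0 < f s x -> f s' x = 0.
  move=> sS s'S ss' /[dup] h /fE; have := f0 s' x; rewrite le_eqVlt.
  case/orP => [/eqP//|h'].
  have := fE _ _ h'; have := sep _ _ sS s'S ss'; have := dT s x s'.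
  rewrite (dC x s'); lra.
have edge x y : \sum_(s in S) `|f s x - f s y| <= d x y.
  (* If one [f s] is positive at both ends, disjointness makes all other terms vanish; otherwise at
     most one function is positive at each end. *)
  have [/existsP[s /and3P[sS fsx fsy]]|/existsPn nboth] :=
    boolP [exists s, [&& s \in S, 0 < f s x & 0 < f s y]].
    rewrite (bigD1 s) //= big1 ?addr0 // => s' /andP[s'S s's].
    have ss' : s != s' by rewrite eq_sym.
    by rewrite (sepf s s' x) // (sepf s s' y) // subrr normr0.
  apply: (@le_trans _ _ (\sum_(s in S) f s x + \sum_(s in S) f s y)).
    rewrite -big_split; apply: ler_sum => s _.
    by rewrite (le_trans (ler_normB _ _))// !ger0_norm.
  have single z : \sum_(s in S) f s z = 0 \/
      exists2 s, s \in S & 0 < f s z /\ \sum_(s in S) f s z = f s z.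
    have [/existsP[s /andP[sS fsz]]|/existsPn nz] :=
      boolP [exists s, (s \in S) && (0 < f s z)].
      right; exists s => //; split=> //.
      rewrite (bigD1 s) //= big1 ?addr0 // => s' /andP[s'S s's].
      by apply: (sepf s) => //; rewrite eq_sym.
    left; apply: big1 => s sS; apply/eqP; rewrite eq_le f0 andbT leNgt.
    by have := nz s; rewrite sS.
  have zero s z : ~~ (0 < f s z) -> f s z = 0.
    by rewrite -leNgt => h; apply/eqP; rewrite eq_le h f0.
  have [->|[s sS [fsx ->]]] := single x; have [->|[s' s'S [fsy ->]]] := single y.
  - by rewrite addr0.
  - have := nboth s'; rewrite s'S fsy andbT /= => /zero fx.
    by have := flip s' x y; rewrite fx ler_norml; lra.
  - have := nboth s; rewrite sS fsx /= => /zero fy.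
    by have := flip s x y; rewrite fy ler_norml; lra.
  (* Here the sum is at most [f s x + f s' y = delta - d s x - d s' y], and [delta <= d s s'] with
     the triangle inequality bounds this by [d x y]. *)
  have ss' : s != s'.
    by apply: contraNneq (nboth s) => e; rewrite sS fsx e fsy.
  have := sep _ _ sS s'S ss'; have := dT s x s'; have := dT x y s'.
  by rewrite (fE _ _ fsx) (fE _ _ fsy) (dC y s'); lra.
rewrite mulr_natl -sumr_const.
apply: (@le_trans _ _ (\sum_(s in S) \sum_x \sum_(y | G x y) `|f s x - f s y|)).
  apply: ler_sum => s sS.
  (* A second point of [S] lies outside the support of [f s]; the factor 2 of [connected_variation]
     turns the drop [delta / 2] into [delta]. *)
  have [s' /andP[s'S s's]] : exists s', (s' \in S) && (s' != s).
    move: S1; rewrite (cardsD1 s) sS add1n ltnS card_gt0 => /set0Pn[s'].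
    by rewrite in_setD1 andbC; exists s'.
  apply: le_trans (connected_variation (f s) Gsym (Gconn s s')).
  have fss : f s s = delta / 2 by rewrite /f d0 subr0 max_r // divr_ge0.
  have fss' : f s s' = 0.
    rewrite /f max_l //; have := sep _ _ s'S sS s's; rewrite dC; lra.
  by rewrite fss fss'; lra.
rewrite exchange_big; apply: ler_sum => x _; rewrite exchange_big.
by apply: ler_sum => y _; exact: edge.
Qed.

(** * Harmonic sums *)

(** Takes the place of sorting: removing such an [x] from what is left of [S], again and again,
    costs at most M / #|S|, then M / (#|S| - 1), down to M. *)
Lemma sum_le_harmonic (R : realType) (T : finType) (c : T -> R) (M : R)
    (S : {set T}) :
  (forall S' : {set T}, S' \subset S -> S' != finset.set0 ->
     exists2 x, x \in S' & #|S'|%:R * c x <= M) ->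
  \sum_(x in S) c x <= M * \sum_(i < #|S|) i.+1%:R^-1.
Proof.
move cS: #|S| => n; elim: n S cS => [|n IHn] S cS small.
  by move/eqP: cS; rewrite cards_eq0 => /eqP->; rewrite big_set0 big_ord0 mulr0.
have S0 : S != finset.set0 by rewrite -card_gt0 cS.
have [x xS hx] := small S (subxx _) S0.
rewrite (big_setD1 x) //= big_ord_recr /= mulrDr [leRHS]addrC lerD //.
  by rewrite ler_pdivlMr ?ltr0n // mulrC -cS.
apply: IHn; first by move: cS; rewrite (cardsD1 x) xS add1n => -[].
by move=> S' sub; apply: small; apply: fintype.subset_trans sub _; exact: subsetDl.
Qed.

Lemma harmonic_le_ln (R : realType) (n : nat) : (1 < n)%N ->
  \sum_(i < n) i.+1%:R^-1 <= 3 * ln n%:R :> R.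
Proof.
(* This is ln(1 + x) <= x at x = -1 / (m + 1). *)
have step (m : nat) : (0 < m)%N -> (m.+1%:R^-1 : R) <= ln m.+1%:R - ln m%:R.
  move=> m0; have mR : 0 < (m%:R : R) by rewrite ltr0n.
  rewrite -ln_div ?posrE ?ltr0n // -[leLHS]opprK lerNl -lnV ?posrE ?divr_gt0 ?ltr0n//.
  have -> : (m.+1%:R / m%:R)^-1 = 1 + - m.+1%:R^-1 :> R.
    have -> : m%:R = m.+1%:R - 1 :> R by rewrite -natr1 addrK.
    by rewrite invf_div mulrBl divff ?pnatr_eq0 // div1r.
  apply: le_ln1Dx; rewrite ltrN2 invf_lt1 ?ltr0n // ltr1n.
  by rewrite ltnS.
case: n => [//|[//|n]] _; elim: n => [|n IHn].
  (* The base case n = 2 fixes the constant 3: [step] at 1 gives ln 2 >= 1/2, and 1 + 1/2 = 3 *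
     1/2. *)
  have lin (a b : R) : a + a = 1 -> a <= b -> 1 + a <= 3 * b by lra.
  rewrite !big_ord_recr big_ord0 /= add0r invr1; apply: lin.
    by rewrite -mulr2n -[LHS]mulr_natl divff.
  by have := step 1%N isT; rewrite ln1 subr0.
have lin (a b c s : R) : s <= 3 * b -> 0 < a -> a <= c - b -> s + a <= 3 * c.
  by lra.
rewrite big_ord_recr /=; apply: lin IHn _ (step n.+2 isT).
by rewrite invr_gt0 ltr0n.
Qed.

(** * The greedy rule and its online implementation *)

(** The arriving point is [n.+1] and its candidates are 0, ..., n; the default [ord0], the root, is
    admissible as soon as [h 0 = 0]. *)
Definition nearest (R : realType) (d : nat -> nat -> R) (h : nat -> R)
    (n : nat) : nat :=
  [arg min_(u < ord0 : 'I_n.+1 | h u + 7 * d n.+1 u <= 7 * d n.+1 0%N)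
     d n.+1 u]%O.

(* [heights d n v] is the depth of v in the greedy tree; it is meaningful only for
   v <= n. *)
Fixpoint heights (R : realType) (d : nat -> nat -> R) (n : nat) : nat -> R :=
  if n is m.+1 then
    fun i => if i == n then
               let u := nearest d (heights d m) m in heights d m u + d n u
             else heights d m i
  else fun=> 0.

Definition height (R : realType) (d : nat -> nat -> R) (v : nat) : R :=
  heights d v v.

(** At the root this takes the dummy value 0; guards [0 < v] keep it from becoming an edge. *)
Definition parent (R : realType) (d : nat -> nat -> R) (v : nat) : nat :=
  nearest d (heights d v.-1) v.-1.

Lemma nearest_le (R : realType) (d : nat -> nat -> R) (h : nat -> R) (n : nat) :
  (nearest d h n <= n)%N.
Proof. by rewrite -ltnS ltn_ord. Qed.

Lemma heightsE (R : realType) (d : nat -> nat -> R) (n u : nat) :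
  (u <= n)%N -> heights d n u = height d u.
Proof.
elim: n => [|n IHn]; first by rewrite leqn0 => /eqP->.
rewrite leq_eqVlt => /predU1P[->//|un] /=.
by rewrite ltn_eqF // IHn.
Qed.

Lemma parent_lt (R : realType) (d : nat -> nat -> R) (v : nat) :
  (0 < v)%N -> (parent d v < v)%N.
Proof. by case: v => // v _; rewrite ltnS nearest_le. Qed.

Lemma heightE (R : realType) (d : nat -> nat -> R) (v : nat) :
  (0 < v)%N -> height d v = height d (parent d v) + d v (parent d v).
Proof.
case: v => // v _; rewrite /height /= eqxx heightsE ?nearest_le//.
Qed.

Lemma nearestP (R : realType) (d : nat -> nat -> R) (h : nat -> R) (n : nat) :
  h 0%N = 0 ->
  h (nearest d h n) + 7 * d n.+1 (nearest d h n) <= 7 * d n.+1 0%N /\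
  forall u, (u <= n)%N -> h u + 7 * d n.+1 u <= 7 * d n.+1 0%N ->
    d n.+1 (nearest d h n) <= d n.+1 u.
Proof.
move=> h0; rewrite /nearest; case: arg_minP => /=; first by rewrite h0 add0r.
move=> i hi mini; split=> // u un; exact: (mini (Ordinal (un : (u < n.+1)%N))).
Qed.

Lemma parentP (R : realType) (d : nat -> nat -> R) (v : nat) : (0 < v)%N ->
  height d (parent d v) + 7 * d v (parent d v) <= 7 * d v 0%N /\
  forall u, (u < v)%N -> height d u + 7 * d v u <= 7 * d v 0%N ->
    d v (parent d v) <= d v u.
Proof.
case: v => // v _; rewrite /parent /=.
have [|ok best] := @nearestP R d (heights d v) v; first by rewrite heightsE.
split=> [|u uv]; first by move: ok; rewrite heightsE // nearest_le.
by rewrite -(@heightsE R d v) //; exact: best.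
Qed.

Lemma eq_nearest (R : realType) (d d' : nat -> nat -> R) (h h' : nat -> R)
    (n : nat) :
  (forall u, (u <= n)%N -> d n.+1 u = d' n.+1 u) ->
  (forall u, (u <= n)%N -> h u = h' u) ->
  nearest d h n = nearest d' h' n.
Proof.
move=> dd' hh'; rewrite /nearest dd' //.
have -> : (fun u : 'I_n.+1 => d n.+1 u) = (fun u : 'I_n.+1 => d' n.+1 u).
  by apply/funext => u; rewrite dd' // -ltnS.
have -> // : (fun u : 'I_n.+1 => h u + 7 * d n.+1 u <= 7 * d' n.+1 0%N) =
             (fun u : 'I_n.+1 => h' u + 7 * d' n.+1 u <= 7 * d' n.+1 0%N).
by apply/funext => u; rewrite dd' ?hh' // -ltnS.
Qed.

Lemma eq_heights (R : realType) (d d' : nat -> nat -> R) (n : nat) :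
  (forall i j, (i <= n)%N -> (j <= n)%N -> d i j = d' i j) ->
  heights d n = heights d' n.
Proof.
elim: n => //= n IHn dd'.
have {}IHn : heights d n = heights d' n.
  by apply: IHn => i j i_n j_n; rewrite dd' // leqW.
rewrite IHn (@eq_nearest R d d' _ (heights d' n)) //; last first.
  by move=> u un; rewrite dd' // leqW.
apply/funext => i; case: ifP => // _.
by rewrite dd' // leqW // nearest_le.
Qed.

(** This locality makes the rule online: the matrix revealed at the arrival of [v] already
    determines its parent. *)
Lemma eq_parent (R : realType) (d d' : nat -> nat -> R) (v : nat) : (0 < v)%N ->
  (forall i j, (i <= v)%N -> (j <= v)%N -> d i j = d' i j) ->
  parent d v = parent d' v.
Proof.
case: v => // v _ dd'; apply: eq_nearest => [u uv|u uv].
  by rewrite dd' // leqW.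
by rewrite (@eq_heights R d d') // => i j iv jv; rewrite dd' // leqW.
Qed.

(* [inord] is harmless: [parent _ m] only looks at indices up to m. *)
Definition greedy (R : realType) : online_algorithm R := fun m M =>
  [set e : 'I_m.+1 * 'I_m.+1 | [&& (0 < m)%N, e.1 == m :> nat &
     e.2 == parent (fun i j => M (inord i) (inord j)) m :> nat]]%SET.

(** Replaces the separate matrices of all moments by one distance function on indices, so that the
    online graph becomes a single parent tree. *)
Lemma added_greedy (R : realType) (V : metricType R) (r : V) (t : nat -> V)
    (m i j : nat) :
  added r t (@greedy R) m i j =
  [&& (0 < m)%N, i == m &
      j == parent (fun i j => mdist (Defs.point r t i) (Defs.point r t j)) m].
Proof.
rewrite /added; set d := fun i j : nat => mdist _ _.
have [->|m0] := posnP m.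
  by apply/existsP => -[e /andP[]]; rewrite inE.
have -> : parent d m = parent (fun i j => revealed r t m (inord i) (inord j)) m.
  by apply: eq_parent => // a b am bm; rewrite mxE /d !inordK // ltnS.
set p := parent _ m.
rewrite /=; apply/existsP/andP => [[e /and3P[]]|[/eqP-> /eqP->]].
  rewrite inE => /and3P[_ /eqP e1 /eqP e2] /eqP <- /eqP <-.
  by rewrite e1 e2 !eqxx.
have pm : (p < m.+1)%N by apply: ltnW; exact: parent_lt.
by exists (ord_max, Ordinal pm); rewrite inE /= m0 !eqxx.
Qed.

(** * Trees given by a decreasing parent function, and their cost *)

Section ParentTree.
Variables (n : nat) (par : nat -> nat).
Hypothesis par_lt : forall v, (0 < v)%N -> (par v < v)%N.

Definition parent_rel : rel 'I_n.+1 :=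
  fun i j => [|| (0 < i)%N && (j == par i :> nat) |
                 (0 < j)%N && (i == par j :> nat)].

Lemma parent_rel_lt (i j : 'I_n.+1) : (i < j)%N -> parent_rel i j = (i == par j :> nat).
Proof.
move=> ij; rewrite /parent_rel (leq_ltn_trans _ ij) //=.
case: (posnP i) => //= i0; case: eqP => // ji.
by have := par_lt i0; rewrite -ji ltnNge (ltnW ij).
Qed.

Lemma parent_rel_sym : symmetric parent_rel.
Proof. by move=> i j; rewrite /parent_rel orbC. Qed.

Lemma parent_tree : is_tree parent_rel.
Proof.
have irr : irreflexive parent_rel.
  move=> i; rewrite /parent_rel orbb; case: posnP => //= i0.
  by apply/eqP => e; have := par_lt i0; rewrite -e ltnn.
split=> //; first exact: parent_rel_sym.
- have to0 (x : 'I_n.+1) : connect parent_rel x ord0.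
    have [m] := ubnP x; elim: m x => // m IHm x xm.
    have [x0|x0] := posnP x; first by rewrite (_ : x = ord0) //; exact/val_inj.
    have px : (par x < n.+1)%N by apply: ltn_trans (par_lt x0) _.
    apply: (connect_trans (y := Ordinal px)).
      by apply: connect1; rewrite /parent_rel x0 eqxx.
    by apply: IHm; exact: leq_trans (par_lt x0) _.
  move=> x y; apply: connect_trans (to0 x) _.
  by rewrite (sym_connect_sym parent_rel_sym).
- (* The largest vertex of a cycle has only its parent as a neighbour there. *)
  move=> c cyc; case: c cyc => // z0 c0; set c := z0 :: c0 => cyc.
  have [z zc zmax] := @arg_maxnP _ z0 (mem c) (@nat_of_ord _) (mem_head _ _).
  have [i s defc] := rot_to zc.
  have : ucycle parent_rel (z :: s) by rewrite -defc /ucycle rot_cycle rot_uniq.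
  have sz : {in s, forall y : 'I_n.+1, (y < z)%N}.
    move=> y ys; have : y \in c by rewrite -(mem_rot i) defc inE ys orbT.
    move/zmax => yz; have : (y <= z)%N by [].
    rewrite leq_eqVlt => /predU1P[/val_inj {}yz|//].
    have : uniq (z :: s) by rewrite -defc rot_uniq; case/andP: cyc.
    by rewrite /= -yz ys.
  rewrite -(size_rot i) defc; case: s sz {defc} => // y s sz /andP[/= /andP[zy]].
  rewrite rcons_path => /andP[_ lz] /and3P[_ ys _].
  have yp : y = par z :> nat.
    by apply/eqP; rewrite -parent_rel_lt ?sz ?mem_head // parent_rel_sym.
  have lp : last y s = par z :> nat.
    by apply/eqP; rewrite -parent_rel_lt // sz ?mem_last.
  (* Both neighbours of [z] on the cycle coincide, so distinctness forces [s] to be empty and the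
     cycle to have length 2. *)
  have ly : last y s = y by apply/val_inj; rewrite /= yp lp.
  by case: s ly ys {sz lz lp} => //= a s <-; rewrite mem_last.
Qed.

End ParentTree.

(** Edges are regrouped by their larger endpoint: each non-root [v] is the larger endpoint of
    exactly one edge, the one to its parent. *)
Lemma cost_parent_rel (R : realType) (n : nat) (par : nat -> nat) (d : nat -> nat -> R)
    (D : 'M[R]_n.+1) :
  (forall v, (0 < v)%N -> (par v < v)%N) ->
  (forall i j, d i j = d j i) -> (forall i j, D i j = d i j) ->
  graph_cost D (@parent_rel n par) = \sum_(v < n.+1 | v != ord0) d v (par v).
Proof.
move=> par_lt dC DE; rewrite /graph_cost (exchange_big_dep predT) //= [RHS]big_mkcond /=.
apply: eq_bigr => v _.
have cond (u : 'I_n.+1) : (u < v)%N && parent_rel par u v = (0 < v)%N &&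
    (u == par v :> nat).
  have [uv|vu] /= := ltnP u v.
    by rewrite parent_rel_lt // (leq_ltn_trans _ uv).
  case: posnP => //= v0; apply/esym/eqP => uE.
  by have := par_lt _ v0; rewrite -uE ltnNge vu.
rewrite (eq_bigl _ _ cond) -lt0n.
have [v0|v0] /= := posnP v; first exact: big_pred0.
have pv : (par v < n.+1)%N by apply: ltn_trans (par_lt _ v0) _.
by rewrite (big_pred1 (Ordinal pv)) // DE dC.
Qed.

(** Converts the sum over ordered pairs in [packing] into the cost, which sees only i < j. *)
Lemma graph_cost_double (R : realType) (n : nat) (D : 'M[R]_n) (G : rel 'I_n) :
  (forall i j, D i j = D j i) -> (forall i, D i i = 0) -> symmetric G ->
  \sum_(i < n) \sum_(j < n | G i j) D i j = 2 * graph_cost D G.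
Proof.
move=> DC D0 Gsym; rewrite mulr_natl mulr2n.
have -> : \sum_(i < n) \sum_(j < n | G i j) D i j =
    graph_cost D G + \sum_(i < n) \sum_(j < n | (j < i)%N && G i j) D i j.
  rewrite /graph_cost -big_split; apply: eq_bigr => i _ /=.
  rewrite (bigID (fun j : 'I_n => (i < j)%N)) /=; congr (_ + _).
    by apply: eq_bigl => j; rewrite andbC.
  rewrite [LHS]big_mkcond [RHS]big_mkcond; apply: eq_bigr => j _.
  rewrite -leqNgt leq_eqVlt andbC; have [/val_inj->|] //= := eqVneq (j : nat) i.
  by rewrite ltnn /= D0; case: ifP.
congr (_ + _); rewrite (exchange_big_dep predT) //= /graph_cost.
apply: eq_bigr => i _; apply: eq_big => [j|j _]; last exact: DC.
by rewrite Gsym.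
Qed.

(** * Depth, separation and cost of the greedy tree *)

Section GreedyAnalysis.
Variables (R : realType) (d : nat -> nat -> R).
Hypothesis d0 : forall i, d i i = 0.
Hypothesis dC : forall i j, d i j = d j i.
Hypothesis dT : forall i j l, d i l <= d i j + d j l.

Let pay v := d v (parent d v).

Lemma height_le v : height d v <= 7 * d v 0%N - 6 * (if v is 0 then 0 else pay v).
Proof.
case: v => [|v]; first by rewrite /height d0 !mulr0 subr0.
have := heightE d (ltn0Sn v); have [ok _] := parentP d (ltn0Sn v).
by move: ok; rewrite /pay; lra.
Qed.

(** If [u] was admissible for [v], then [L <= pay v <= d u v]. If not, [height_le] at [u] and the
    triangle inequality through [v] give 14 d(u,v) > 6 L, whence 3/7. *)
Lemma pay_separated u v L : (u < v)%N -> (0 < u)%N -> 0 <= L ->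
  L <= pay u -> L <= pay v -> 3 / 7 * L <= d u v.
Proof.
move=> uv u0 L0 Lu Lv; have v0 := leq_ltn_trans (leq0n u) uv.
have [_ best] := parentP d v0.
have [/(best _ uv)|] := lerP (height d u + 7 * d v u) (7 * d v 0%N).
  by move: Lv; rewrite /pay (dC u v); lra.
have := height_le u; case: u u0 {uv} Lu => // u _ Lu.
by have := dT u.+1 v 0; rewrite (dC v u.+1); lra.
Qed.

(** The root, of depth 0, is always admissible, so even [L <= d v 0] holds; the factor matches
    [pay_separated]. *)
Lemma pay_le_root v L : (0 < v)%N -> 0 <= L -> L <= pay v -> 3 / 7 * L <= d v 0%N.
Proof.
move=> v0 L0 Lv; have [_ /(_ 0%N v0)] := parentP d v0.
rewrite /height /= add0r lexx => /(_ isT); move: Lv; rewrite /pay; lra.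
Qed.

Lemma greedy_cost (n : nat) (D : 'M[R]_n.+1) (T : rel 'I_n.+1) :
  (forall i j, D i j = d i j) -> symmetric T -> (forall x y, connect T x y) ->
  graph_cost D (parent_rel (parent d)) <=
    14 / 3 * graph_cost D T * \sum_(i < n) i.+1%:R^-1.
Proof.
move=> DE Tsym Tconn.
have dge0 x y : 0 <= d x y by have := dT x y x; rewrite d0 (dC y x); lra.
rewrite (@cost_parent_rel _ _ _ d) //; last exact: parent_lt.
rewrite (eq_bigl (mem (~: [set ord0])%SET)); last by move=> v; rewrite !inE.
have := @sum_le_harmonic R _ (fun v : 'I_n.+1 => pay v) (14 / 3 * graph_cost D T)
  (~: [set ord0])%SET.
rewrite cardsC1 card_ord; apply => S Ssub /set0Pn[x0 x0S].
(* With [x] the cheapest payer of [S], [pay x] serves as the common threshold L. *)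
have [x xS xmin] := @arg_minP _ _ _ x0 (mem S) (fun v : 'I_n.+1 => pay v) x0S.
exists x => //; rewrite -/(pay x).
have S0 v : v \in S -> (0 < v)%N.
  by move=> /(fintype.subsetP Ssub); rewrite !inE lt0n.
have pay0 : 0 <= pay x by exact: dge0.
have n0S : ord0 \notin S by apply/negP => /S0.
(* Adding the root yields two points even when [S] is a singleton. The 2 of double counting divided
   by 3/7 is the constant 14/3. *)
have : #|ord0 |: S|%:R * (3 / 7 * pay x) <= 2 * graph_cost D T.
  rewrite -graph_cost_double //; last by move=> i; rewrite DE.
    apply: packing => //.
    - by move=> i; rewrite DE.
    - by move=> i j; rewrite !DE.
    - by move=> i j l; rewrite !DE.
    - by rewrite mulr_ge0.
    - by rewrite cardsU1 n0S ltnS card_gt0; apply/set0Pn; exists x.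
    move=> u v; rewrite !in_setU1 => uS vS uv.
    (* Ordering the pair by arrival puts [v] in [S] and leaves only [u] as a possible root. *)
    wlog ltuv : u v uS vS uv / (u < v)%N => [wl|].
      have := uv; rewrite neq_ltn => /orP[|vu]; first exact: wl.
      by rewrite DE dC -DE; apply: wl; rewrite // eq_sym.
    have v0 : (0 < v)%N by apply: leq_ltn_trans ltuv.
    have {}vS : v \in S by case/predU1P: vS v0 => // ->.
    case/predU1P: uS => [->|uS]; first by rewrite DE dC pay_le_root // xmin.
    by rewrite DE pay_separated // ?xmin // S0.
  by move=> i j; rewrite !DE.
rewrite cardsU1 n0S natrD mulrDl mul1r /=; move: pay0.
have lin (s p c : R) : 0 <= p -> 3 / 7 * p + s * (3 / 7 * p) <= 2 * c ->
    s * p <= 14 / 3 * c.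
  by lra.
exact: lin.
Qed.

(** Climbing from parent to parent follows the recursion [heightE], so depth is the length of an
    actual walk. *)
Lemma greedy_walk (n : nat) (D : 'M[R]_n.+1) (x : 'I_n.+1) :
  (forall i j, D i j = d i j) ->
  exists p, [/\ path (parent_rel (parent d)) x p, last x p = ord0 &
                walk_length D x p = height d x].
Proof.
move=> DE; have [m] := ubnP x; elim: m x => // m IHm x xm.
have [x0|x0] := posnP x.
  exists [::]; split=> //; first exact/val_inj.
  by rewrite /walk_length big_nil x0.
have px : (parent d x < n.+1)%N by apply: ltn_trans (parent_lt d x0) _.
have [|p [Gp lp wp]] := IHm (Ordinal px); first exact: leq_trans (parent_lt d x0) _.
exists (Ordinal px :: p); split=> //=; first by rewrite Gp /parent_rel x0 eqxx.
by rewrite /walk_length /= big_cons -/(walk_length D _ _) wp DE (heightE d x0) addrC.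
Qed.

End GreedyAnalysis.

(* The metric space, the root and the arrival sequence are quantified after the
   algorithm, as is the number k of terminals that have arrived so far.  The cost
   bound is stated for k >= 2 because ln 1 = 0; for k <= 1 the graph on root and
   terminals has a single spanning tree, so the tree claim determines the cost. *)
Theorem theorem4 (R : realType) :
  exists (A : online_algorithm R) (C : R),
    forall (V : metricType R) (r : V) (t : nat -> V) (k : nat),
      let D := revealed r t k in
      let H := online_graph r t A (n := k) in
      [/\ is_tree H,
          (1 < k)%N ->
            forall T : rel 'I_k.+1, is_mst D T ->
              graph_cost D H <= C * ln k%:R * graph_cost D T &
          forall i : 'I_k,
            (graph_dist D H (lift ord0 i) ord0 <= (7 * mdist (t i) r)%:E)%E].
Proof.
(* 14 is the product of 14/3 from [greedy_cost] and 3 from [harmonic_le_ln]. *)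
exists (@greedy R), 14 => V r t k D H.
pose d i j := mdist (Defs.point r t i) (Defs.point r t j).
have d0 i : d i i = 0 by exact: mdistxx.
have dC i j : d i j = d j i by exact: metric_sym.
have dT i j l : d i l <= d i j + d j l by exact: metric_triangle.
have DE i j : D i j = d i j by rewrite mxE.
have HE : H = parent_rel (parent d).
  apply/funext => i; apply/funext => j; apply/existsP/orP => [[m]|].
    rewrite !added_greedy => /orP[] /and3P[m0 /eqP-> jE].
      by left; rewrite m0.
    by right; rewrite m0.
  (* An edge is added at the moment numbered by its child endpoint. *)
  by case=> /andP[v0 uE]; [exists i|exists j]; rewrite !added_greedy v0 eqxx uE ?orbT.
rewrite HE; split=> [|k1 T [[_ Tsym Tconn _] _]|i].
- by apply: parent_tree; exact: parent_lt.
- have cost0 : 0 <= graph_cost D T.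
    by rewrite sumr_ge0 // => i _; rewrite sumr_ge0 // => j _; rewrite DE mdist_ge0.
  apply: le_trans (greedy_cost d0 dC dT DE Tsym Tconn) _.
  have -> : 14 * ln k%:R * graph_cost D T = 14 / 3 * graph_cost D T * (3 * ln k%:R).
    by field.
  by rewrite ler_wpM2l ?harmonic_le_ln // mulr_ge0.
- have [p [Gp lp wp]] := greedy_walk (lift ord0 i) DE.
  (* The climbing walk bounds the infimum, and [height_le] bounds its length after the nonnegative
     term 6 pay is dropped. *)
  apply: (@le_trans _ _ (walk_length D (lift ord0 i) p)%:E).
    by apply: ereal_inf_lbound; exists p.
  rewrite lee_fin wp; apply: le_trans (height_le d0 _) _.
  by rewrite /= lerBlDr lerDl mulr_ge0 // mdist_ge0.
Qed.
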